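(* For all $m, n, k \in \mathbb{Z}_+=\{0,1,2,\dots\}$ with $m+n > 2k$, $$\sum_{j=0}^{n+m-2k}\binom{n+m-2k}{j}(-1)^{j}E_{j+2k} = \begin{cases} 2+E_{n+m} & \text{if } k=0,\\[2mm] \displaystyle\sum_{j=0}^{2k}\binom{2k}{j}(-1)^{j+2k}E_{n+m-j} & \text{if } k>0.\end{cases}$$
   Context: The Euler numbers $E_n\in\mathbb{Q}$ ($n\ge 0$) are defined by $\frac{2}{e^t+1} = \sum_{n=0}^{\infty} E_n \frac{t^n}{n!}$. *)

(* Defs.v *)
From mathcomp Require Import all_boot all_order all_algebra.
Set Implicit Arguments.
Unset Strict Implicit.
Unset Printing Implicit Defensive.
Import GRing.Theory Num.Theory.
Local Open Scope ring_scope.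

(* Formal power series over the rationals: [f n] is the coefficient of t^n.
   Series are compared coefficientwise, with [=1]. *)
Definition fps := nat -> rat.

Definition fps_const (c : rat) : fps := fun n => if n == 0%N then c else 0.

Definition fps_add (f g : fps) : fps := fun n => f n + g n.

Definition fps_mul (f g : fps) : fps :=
  fun n => \sum_(i < n.+1) f i * g (n - i)%N.

(* The first n coefficients of 1 / f; only meaningful when f 0 != 0. *)
Fixpoint fps_inv_seq (f : fps) (n : nat) : seq rat :=
  if n is n'.+1 then
    let s := fps_inv_seq f n' in
    rcons s (((n' == 0%N)%:R - \sum_(i < n') s`_i * f (n' - i)%N) / f 0%N)
  else [::].

Definition fps_inv (f : fps) : fps := fun n => (fps_inv_seq f n.+1)`_n.

Definition fps_div (f g : fps) : fps := fps_mul f (fps_inv g).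

Definition egf (a : nat -> rat) : fps := fun n => a n / (n`!)%:R.

Definition fps_exp : fps := egf (fun _ => 1).

(* 2 / (e^t + 1) = \sum_n euler n * t^n / n!; see [euler_egf]. *)
Definition euler (n : nat) : rat :=
  (n`!)%:R * fps_div (fps_const 2) (fps_add fps_exp (fps_const 1)) n.

Lemma size_fps_inv_seq f n : size (fps_inv_seq f n) = n.
Proof. by elim: n => //= n IHn; rewrite size_rcons IHn. Qed.

Lemma nth_fps_inv_seq f n i : (i < n)%N -> (fps_inv_seq f n)`_i = fps_inv f i.
Proof.
elim: n => // n IHn; rewrite ltnS leq_eqVlt => /predU1P [-> // | lt_in].
by rewrite /= nth_rcons size_fps_inv_seq lt_in IHn.
Qed.

Lemma fps_mulVf f : f 0%N != 0 -> fps_mul (fps_inv f) f =1 fps_const 1.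
Proof.
move=> f0 n; rewrite /fps_mul big_ord_recr /= subnn.
rewrite {2}/fps_inv /= nth_rcons size_fps_inv_seq ltnn eqxx divfK //.
under eq_bigr => i _ do rewrite -(nth_fps_inv_seq f (ltn_ord i)).
by rewrite addrC subrK /fps_const; case: eqP.
Qed.

Lemma fps_mul_constl c f n : fps_mul (fps_const c) f n = c * f n.
Proof.
rewrite /fps_mul big_ord_recl subn0 big1 ?addr0 // => i _.
by rewrite /fps_const /= mul0r.
Qed.

Lemma fps_divfK_const c f :
  f 0%N != 0 -> fps_mul (fps_div (fps_const c) f) f =1 fps_const c.
Proof.
move=> f0 n.
transitivity (c * fps_mul (fps_inv f) f n).
  rewrite {1}/fps_mul mulr_sumr; apply: eq_bigr => i _.
  by rewrite /fps_div fps_mul_constl mulrA.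
by rewrite (fps_mulVf f0) /fps_const; case: eqP; rewrite (mulr1, mulr0).
Qed.

Lemma euler_egf :
  egf euler =1 fps_div (fps_const 2) (fps_add fps_exp (fps_const 1)).
Proof.
move=> n; rewrite /egf /euler mulrC mulKf // pnatr_eq0 -lt0n; exact: fact_gt0.
Qed.

Lemma euler_egf_mul :
  fps_mul (egf euler) (fps_add fps_exp (fps_const 1)) =1 fps_const 2.
Proof.
move=> n; rewrite -(@fps_divfK_const 2 (fps_add fps_exp (fps_const 1))) //.
by apply: eq_bigr => i _; rewrite euler_egf.
Qed.

(* Main.v *)
Require Import Defs.
From HB Require Import structures.
From mathcomp Require Import all_boot all_order all_algebra.
From mathcomp Require Import ring lra.
Set Implicit Arguments.
Unset Strict Implicit.
Import GRing.Theory Num.Theory.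
Local Open Scope ring_scope.

(* Let [L] be the linear functional on polynomials sending x^n to E_n.  The
   generating function says L(p(x+1)) + L(p(x)) = 2 p(0), and this determines
   [L].  Hence L(p(-x)) = 2 p(0) - L(p(x)), and combining the two identities
   gives L(p(1-x)) = L(p(x)) + 2 (p(1) - p(0)).  The result is the case
   p = x^(m+n-2k) (1-x)^(2k): if k = 0 then p(1) - p(0) = 1, otherwise p
   vanishes at both 0 and 1. *)

Definition umbral (R : comNzRingType) (a : nat -> R) (p : {poly R}) : R :=
  \sum_(i < size p) p`_i * a i.

Lemma umbral_wide (R : comNzRingType) (a : nat -> R) (n : nat) (p : {poly R}) :
  (size p <= n)%N -> umbral a p = \sum_(i < n) p`_i * a i.
Proof.
move=> le_pn; rewrite /umbral (big_ord_widen n (fun i => p`_i * a i) le_pn).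
rewrite [RHS](bigID (fun i : 'I_n => (i < size p)%N)) /=.
rewrite [X in _ = _ + X]big1 ?addr0 // => i.
by rewrite -leqNgt => le_pi; rewrite nth_default ?mul0r.
Qed.

Lemma umbral_is_linear (R : comNzRingType) (a : nat -> R) : scalar (umbral a).
Proof.
move=> c p q; pose n := maxn (size p) (size q).
have le_pn : (size p <= n)%N by apply: leq_maxl.
have le_qn : (size q <= n)%N by apply: leq_maxr.
have le_cpq : (size (c *: p + q)%R <= n)%N.
  rewrite (leq_trans (size_polyD _ _)) // geq_max le_qn andbT.
  exact: leq_trans (size_scale_leq _ _) le_pn.
rewrite !(@umbral_wide _ _ n) // mulr_sumr -big_split /=.
by apply: eq_bigr => i _; rewrite coefD coefZ mulrDl mulrA.
Qed.

HB.instance Definition _ (R : comNzRingType) (a : nat -> R) :=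
  GRing.isLinear.Build R {poly R} R _ (umbral a) (umbral_is_linear a).

Lemma umbralZ (R : comNzRingType) (a : nat -> R) (c : R) (p : {poly R}) :
  umbral a (c *: p) = c * umbral a p.
Proof. exact: scalarZ. Qed.

Lemma umbralXn (R : comNzRingType) (a : nat -> R) (n : nat) :
  umbral a 'X^n = a n.
Proof.
rewrite /umbral size_polyXn big_ord_recr /= coefXn eqxx mul1r big1 ?add0r //.
by move=> i _; rewrite coefXn ltn_eqF ?mul0r.
Qed.

(** Linearity is a hypothesis on a bare function, so that [f] can later be an ad hoc difference of
    two sides of an identity. *)
Lemma scalar_sum_Xn (R : comNzRingType) (f : {poly R} -> R) (p : {poly R}) :
  scalar f -> f p = \sum_(i < size p) p`_i * f 'X^i.
Proof.
move=> lin_f.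
have f0 : f 0 = 0.
  by have := lin_f (-1) 0 0; rewrite scaler0 add0r mulN1r addNr.
rewrite -{1}[p]coefK poly_def.
elim/big_rec2: _ => [//|i x y _ <-].
by rewrite lin_f.
Qed.

Lemma scalar_eq0 (R : comNzRingType) (f : {poly R} -> R) :
  scalar f -> (forall n, f 'X^n = 0) -> f =1 fun=> 0.
Proof.
move=> lin_f fX0 p; rewrite (scalar_sum_Xn p lin_f) big1 // => i _.
by rewrite fX0 mulr0.
Qed.

(** Compares coefficients of t^n in [euler_egf_mul], multiplied by n!. *)
Lemma euler_recurrence (n : nat) :
  \sum_(i < n.+1) 'C(n, i)%:R * euler i + euler n = (n == 0%N)%:R * 2.
Proof.
have fn (i : nat) : (i`!)%:R != 0 :> rat by rewrite pnatr_eq0 -lt0n fact_gt0.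
have -> : (n == 0%N)%:R * 2 = (n`!)%:R * fps_const 2 n :> rat.
  by rewrite /fps_const; case: eqP => [->|_]; rewrite ?mul1r ?mul0r ?mulr0.
rewrite -euler_egf_mul /fps_mul /fps_add.
under [in RHS]eq_bigr => i _ do rewrite mulrDr.
rewrite big_split mulrDr; congr (_ + _).
  rewrite mulr_sumr; apply: eq_bigr => i _.
  have le_in : (i <= n)%N by rewrite -ltnS.
  rewrite -(bin_fact le_in) !natrM /fps_exp /egf.
  by field; rewrite !fn.
(* The constant series 1 leaves only the term i = n. *)
rewrite big_ord_recr /= big1 ?add0r => [|i _].
  by rewrite subnn /fps_const /egf /=; field; rewrite fn.
by rewrite /fps_const subn_eq0 leqNgt ltn_ord mulr0.
Qed.

(** Both sides are linear in [p]; on 'X^n the binomial expansion reduces the claim to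
    [euler_recurrence]. *)
Lemma euler_shift (p : {poly rat}) :
  umbral euler (p \Po ('X + 1)) + umbral euler p = 2 * p.[0].
Proof.
apply/eqP; rewrite -subr_eq0; apply/eqP; move: p.
apply: scalar_eq0 => [c p q|n].
  rewrite comp_polyD comp_polyZ !umbral_is_linear hornerD hornerZ.
  ring.
rewrite comp_Xn_poly exprDn_comm; last exact: commr1.
rewrite raddf_sum umbralXn hornerXn expr0n.
apply/eqP; rewrite subr_eq0 [2 * _]mulrC -euler_recurrence.
apply/eqP; congr (_ + _).
rewrite (reindex_inj rev_ord_inj) /=; apply: eq_bigr => i _.
have le_in : (i <= n)%N by rewrite -ltnS.
by rewrite expr1n mulr1 raddfMn /= umbralXn subSS bin_sub // subKn // mulr_natl.
Qed.

(** Induction on n for 'X^n: (X+1)^n is monic of degree n and [f] kills its lower terms, so the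
    hypothesis becomes 2 f(X^n) = 0. *)
Lemma scalar_antiperiodic_eq0 (R : numDomainType) (f : {poly R} -> R) :
  scalar f -> (forall p, f (p \Po ('X + 1)) + f p = 0) -> f =1 fun=> 0.
Proof.
move=> lin_f f_anti; apply: scalar_eq0 => // n.
elim/ltn_ind: n => n IHn.
have := f_anti 'X^n; rewrite (@scalar_sum_Xn _ f ('X^n \Po _)) //.
have -> : size ('X^n \Po ('X + 1) : {poly R}) = n.+1.
  by rewrite comp_Xn_poly -[1]opprK -polyCN size_exp_XsubC.
rewrite big_ord_recr /= big1 => [|i _]; last by rewrite IHn ?mulr0.
have -> : ('X^n \Po ('X + 1))`_n = 1 :> R.
  have /monicP := monic_exp n (monicXsubC (-1 : R)).
  by rewrite lead_coefE size_exp_XsubC polyCN opprK comp_Xn_poly.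
rewrite add0r mul1r -mulr2n => /eqP.
by rewrite mulrn_eq0 /= => /eqP.
Qed.

(** The difference of the two sides, as a functional of [p], is antiperiodic under x -> x+1, hence
    zero. *)
Lemma euler_opp (p : {poly rat}) :
  umbral euler (p \Po (- 'X)) = 2 * p.[0] - umbral euler p.
Proof.
apply/eqP; rewrite -subr_eq0; apply/eqP; move: p.
apply: scalar_antiperiodic_eq0 => [c p q|p].
  rewrite comp_polyD comp_polyZ !umbral_is_linear hornerD hornerZ.
  ring.
have e1 := euler_shift p.
(* This is p(1-x): its shift is p(-x) and its value at 0 is p(1). *)
have := euler_shift (p \Po ('X + 1) \Po (- 'X)).
have -> : (p \Po ('X + 1) \Po (- 'X)) \Po ('X + 1) = p \Po (- 'X).
  rewrite -!comp_polyA; congr (_ \Po _).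
  by rewrite comp_polyD comp_polyX rmorph1 rmorphN /= comp_polyX opprD addrNK.
rewrite !horner_comp !(hornerD, hornerN, hornerX, hornerC) oppr0 !add0r.
lra.
Qed.

Lemma euler_reflection (p : {poly rat}) :
  umbral euler (p \Po (1 - 'X)) = umbral euler p + 2 * (p.[1] - p.[0]).
Proof.
have e1 := euler_shift p.
have := euler_opp (p \Po ('X + 1)).
have -> : (p \Po ('X + 1)) \Po (- 'X) = p \Po (1 - 'X).
  rewrite -comp_polyA; congr (_ \Po _).
  by rewrite comp_polyD comp_polyX rmorph1 addrC.
rewrite !horner_comp !(hornerD, hornerX, hornerC) add0r.
lra.
Qed.

(** Both sums of the theorem have this shape, with r and s exchanged. *)
Lemma umbral_XnM_1subX (R : comNzRingType) (a : nat -> R) (r s : nat) :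
  umbral a ('X^r * (1 - 'X) ^+ s)
  = \sum_(j < s.+1) 'C(s, j)%:R * (-1) ^+ j * a (j + r)%N.
Proof.
rewrite exprBn mulr_sumr raddf_sum; apply: eq_bigr => j _.
rewrite expr1n mulr1 mulrnAr mulrCA -exprD raddfMn /=.
have -> : (-1) ^+ j * 'X^(r + j) = (-1) ^+ j *: 'X^(r + j) :> {poly R}.
  by rewrite -mul_polyC polyC_exp polyCN.
by rewrite umbralZ umbralXn addnC -mulrA mulr_natl.
Qed.

Theorem corollary7 (m n k : nat) (hk : (2 * k < m + n)%N) :
  \sum_(j < (n + m - 2 * k).+1)
     'C(n + m - 2 * k, j)%:R * (-1) ^+ j * euler (j + 2 * k)
  = (if k == 0%N then 2 + euler (n + m)
     else \sum_(j < (2 * k).+1)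
            'C(2 * k, j)%:R * (-1) ^+ (j + 2 * k) * euler (n + m - j)) :> rat.
Proof.
rewrite addnC in hk; set M := (n + m - 2 * k)%N.
have M_gt0 : (0 < M)%N by rewrite subn_gt0.
have nmE : (n + m = M + 2 * k)%N by rewrite subnK // ltnW.
rewrite -umbral_XnM_1subX.
(* The substitution x -> 1-x swaps the two factors. *)
have -> : 'X^(2 * k) * (1 - 'X) ^+ M
    = ('X^M * (1 - 'X) ^+ (2 * k)) \Po (1 - 'X) :> {poly rat}.
  rewrite comp_polyM comp_Xn_poly rmorphXn /= comp_polyB comp_polyX rmorph1.
  by rewrite subKr mulrC.
rewrite euler_reflection !hornerM !horner_exp !(hornerD, hornerN, hornerX, hornerC).
(* The value at 0 vanishes because M > 0; the value at 1 is 0^(2k), which is 1 exactly when k =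
   0. *)
rewrite expr1n subrr !expr0n (gtn_eqF M_gt0) mul0r subr0 mul1r muln_eq0 /=.
case: eqP => [k0|_].
  by rewrite k0 muln0 expr0 mulr1 umbralXn mulr1 addrC nmE k0 muln0 addn0.
(* Reversing j to 2k - j turns the index j + M into n + m - j; the sign agrees since 2k - j and j +
   2k have equal parity. *)
rewrite mulr0 addr0 umbral_XnM_1subX (reindex_inj rev_ord_inj) /=.
apply: eq_bigr => j _.
have le_jk : (j <= 2 * k)%N by rewrite -ltnS.
rewrite subSS bin_sub // nmE addnC addnBA //; congr (_ * _ * _).
by rewrite -signr_odd oddB // addbC -oddD signr_odd.
Qed.
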